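(* Let $B$ and $C$ be commutative rings, let $A$ be a ring that is a free right $B$-module with ordered basis $e=(e_1,\dots,e_m)$, and let $B$ be a free right $C$-module with ordered basis $f=(f_1,\dots,f_n)$. Let $L_2:B\to \mathrm{M}(n,C)$ and $L_3:\mathrm{M}(r,B)\to \mathrm{M}(n,\mathrm{M}(r,C))\subset \mathrm{M}(nr,C)$ be the left regular representations with respect to $f$ and $(f_1I_r,\dots,f_nI_r)$. Let $\rho:A\to \mathrm{M}(r,B)$ be a ring homomorphism. Let $\bar C$ be a commutative ring with $C\subset\bar C$ and assume that $L_3\circ\rho$ and $L_2$ decompose over $\bar C$ as direct sums $$L_3\circ\rho\sim \varphi^{(1)}\oplus\cdots\oplus\varphi^{(s)},\qquad L_2\sim\psi^{(1)}\oplus\cdots\oplus\psi^{(t)},$$ with $\varphi^{(i)}(a)\in \mathrm{M}(r_i,\bar C)$ for $a\in A$ and $\psi^{(j)}(b)\in \mathrm{M}(n_j,\bar C)$ for $b\in B$. Let $\mathfrak X=\sum_{\alpha\in ef}\alpha x_\alpha\in A[x_\alpha]$ be the general element for $ef=\{e_if_j\mid 1\le i\le m,\ 1\le j\le n\}$. Then $$\prod_{i=1}^s \det\big(\varphi^{(i)}(\mathfrak X)\big)=\det\big(L_3(\rho(\mathfrak X))\big)=\det\Big(L_2\big(\det(\rho(\mathfrak X))\big)\Big)=\prod_{j=1}^t\det\Big(\psi^{(j)}\big(\det(\rho(\mathfrak X))\big)\Big),$$ where $\det(\rho(\mathfrak X))\in B[x_\alpha]$ is the determinant of a matrix in $\mathrm{M}(r,B[x_\alpha])$,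 and the other determinants are those of matrices in $\mathrm{M}(r_i,\bar C[x_\alpha])$, $\mathrm{M}(nr,C[x_\alpha])$, $\mathrm{M}(n,C[x_\alpha])$ and $\mathrm{M}(n_j,\bar C[x_\alpha])$ respectively.
   Context: Rings have a multiplicative unit; $\mathrm{M}(k,R)$ is the ring of $k\times k$ matrices over $R$. ''$A$ is a free right $B$-module with ordered basis $e$'' means that $B$ is a subring of $A$ and $A=\bigoplus_i e_iB$. The left regular representation $L_e:A\to \mathrm{M}(m,B)$ with respect to $e$ is the injective ring homomorphism $a\mapsto(b_{ij})$ defined by $ae_j=\sum_i e_ib_{ij}$. One has $\mathrm{M}(r,B)=\bigoplus_{i=1}^n(f_iI_r)\mathrm{M}(r,C)$, and $L_3$ is defined with respect to this basis; block matrices in $\mathrm{M}(n,\mathrm{M}(r,C))$ are regarded as elements of $\mathrm{M}(nr,C)$. $\{x_\alpha\mid\alpha\in ef\}$ is a set of independent commuting variables, and $R[x_\alpha]$ denotes the polynomial ring in these variables with coefficients in $R$. Every ring homomorphism $\rho:R\to R'$ is regarded as a ring homomorphism $R[x_\alpha]\to R'[x_\alpha]$ by $\rho(x_\alpha 1_R)=x_\alpha\rho(1_R)$ (i.e. applied to coefficients), and $\mathrm{M}(k,R)[x_\alpha]$ is identified with $\mathrm{M}(k,R[x_\alpha])$. The symbol $\sim$ means equivalence of representations over $\bar C$ (simultaneous conjugation by one invertible matrix over $\bar C$), and the $\varphi^{(i)}$, $\psi^{(j)}$ are ring homomorphisms from $A$, respectively $B$. *)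

(* Defs.v *)
From HB Require Import structures.
From mathcomp Require Import all_boot all_order all_algebra.
From mathcomp Require Export mpoly.

Set Implicit Arguments.
Unset Strict Implicit.
Unset Printing Implicit Defensive.

Import GRing.Theory.
Local Open Scope ring_scope.

(* Subrings are represented by injective ring morphisms iota : B -> A, so that
   the right action of b : B on a : A is a * iota b.  The image of iota is not
   assumed to be central in A. *)
Definition right_basis (A B : pzRingType) (iota : {rmorphism B -> A})
    (m : nat) (e : 'I_m -> A) : Prop :=
  injective iota /\
  forall a : A, exists! b : {ffun 'I_m -> B}, a = \sum_i e i * iota (b i).

Section LeftRegular.

Variables (A B : pzRingType) (iota : {rmorphism B -> A}).
Variables (m : nat) (e : 'I_m -> A).
Hypothesis he : right_basis iota e.

Lemma right_basis_ex (a : A) :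
  exists b : {ffun 'I_m -> B}, a == \sum_i e i * iota (b i).
Proof. by have [b [/eqP ab _]] := he.2 a; exists b. Qed.

Definition coordinates (a : A) : {ffun 'I_m -> B} := xchoose (right_basis_ex a).

Lemma coordinatesE (a : A) : a = \sum_i e i * iota (coordinates a i).
Proof. exact/eqP/(xchooseP (right_basis_ex a)). Qed.

Lemma coordinates_uniq (a : A) (b : {ffun 'I_m -> B}) :
  a = \sum_i e i * iota (b i) -> coordinates a = b.
Proof.
move=> ab; have [c [_ c_uniq]] := he.2 a.
by rewrite -(c_uniq _ (coordinatesE a)) (c_uniq _ ab).
Qed.

Definition left_regular (a : A) : 'M[B]_m :=
  \matrix_(i, j) coordinates (a * e j) i.

Lemma left_regularE (a : A) (j : 'I_m) :
  a * e j = \sum_i e i * iota (left_regular a i j).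
Proof.
rewrite [LHS]coordinatesE; apply: eq_bigr => i _.
by rewrite mxE.
Qed.

End LeftRegular.

Lemma right_basis_scalar_mx (B C : comPzRingType) (iota : {rmorphism C -> B})
    (n r : nat) (f : 'I_n -> B) :
  right_basis iota f ->
  right_basis (map_mx iota : {rmorphism 'M[C]_r -> 'M[B]_r})
    (fun i => (f i)%:M).
Proof.
move=> hf; split=> [M N /matrixP MN|M].
  by apply/matrixP => u v; apply: hf.1; have := MN u v; rewrite !mxE.
have sumE (N : {ffun 'I_n -> 'M[C]_r}) u v :
    (\sum_i (f i)%:M * (map_mx iota (N i) : 'M[B]_r)) u v
      = \sum_i f i * iota ([ffun i => N i u v] i).
  rewrite summxE; apply: eq_bigr => i _.
  by rewrite -mulmxE mul_scalar_mx !mxE ffunE.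
exists [ffun i => \matrix_(u, v) coordinates hf (M u v) i]; split.
  apply/matrixP => u v; rewrite sumE [LHS](coordinatesE hf).
  by apply: eq_bigr => i _; rewrite !ffunE mxE.
move=> N MN; apply/ffunP => i; apply/matrixP => u v; rewrite ffunE mxE.
have /(coordinates_uniq hf) -> :
    M u v = \sum_i f i * iota ([ffun i => N i u v] i) by rewrite {1}MN sumE.
by rewrite ffunE.
Qed.

Lemma flatten_mx_size (n r : nat) : (\sum_(i < n) r = n * r)%N.
Proof. by rewrite sum_nat_const card_ord. Qed.

Definition flatten_mx (R : Type) (n r : nat) (M : 'M['M[R]_r]_n) :
    'M[R]_(n * r) :=
  castmx (flatten_mx_size n r, flatten_mx_size n r)
    (\mxblock_(i < n, j < n) M i j).

(* The base ring need not have computable inverses, so the conjugating matrix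
   comes with its inverse Q. *)
Definition rep_equiv (K : comNzRingType) (T : Type) (p q : nat)
    (R1 : T -> 'M[K]_p) (R2 : T -> 'M[K]_q) : Prop :=
  exists (eqp : q = p) (P Q : 'M[K]_p),
    [/\ P *m Q = 1%:M, Q *m P = 1%:M
      & forall a, R1 a = P *m castmx (eqp, eqp) (R2 a) *m Q].

(* M(k, R)[x] is represented throughout by M(k, R[x]).  The next two definitions
   apply f to coefficients, for f defined on a coefficient ring S and for f
   defined on a matrix ring M(k, S), respectively. *)
Definition ext_mpoly (S R : nzRingType) (N k : nat) (f : S -> 'M[R]_k)
    (p : {mpoly S[N]}) : 'M[{mpoly R[N]}]_k :=
  \matrix_(i, j) map_mpoly (fun a => f a i j) p.

Definition mx_msupp (S : nzRingType) (N k : nat) (M : 'M[{mpoly S[N]}]_k) :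
    seq 'X_{1..N} :=
  undup (flatten [seq msupp (M ij.1 ij.2) | ij : 'I_k * 'I_k]).

Definition ext_mx_mpoly (S R : nzRingType) (N k l : nat)
    (f : 'M[S]_k -> 'M[R]_l) (M : 'M[{mpoly S[N]}]_k) :
    'M[{mpoly R[N]}]_l :=
  \matrix_(i, j) \sum_(mu <- mx_msupp M)
    f (map_mx (mcoeff mu) M) i j *: 'X_[mu].

(* The variable attached to e_i f_j is the one of index mxvec_index i j. *)
Definition general_element (A B : nzRingType) (iota : {rmorphism B -> A})
    (m n : nat) (e : 'I_m -> A) (f : 'I_n -> B) : {mpoly A[m * n]} :=
  \sum_(i < m) \sum_(j < n) (e i * iota (f j)) *: 'X_(mxvec_index i j).

(* Main.v *)
(* The middle equality rests on the determinant theorem for block matrices with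
   commuting blocks: for a ring morphism L : B -> M(n, C) with B and C
   commutative, the matrix with blocks L (M i j) has determinant det (L (det M)).
   This is proved by induction on the size of M.  If det (L a) is a nonzerodivisor
   for the corner entry a of M, multiplying M on the left by a lower triangular
   matrix clears its first column, and both sides are multiplicative in M.  In
   general one applies this to M + X over B[X], where det (L (a + X)) is a
   characteristic polynomial, hence monic, and then sets X = 0.  The outer
   equalities express that a determinant over C[x] is invariant under conjugation
   by constant matrices and is multiplicative on block diagonal matrices. *)
Require Import Defs.
From HB Require Import structures.
From mathcomp Require Import all_boot all_order all_fingroup all_algebra.

Set Implicit Arguments.
Unset Strict Implicit.
Unset Printing Implicit Defensive.

Import GRing.Theory.
Local Open Scope ring_scope.

(** * Determinants of block diagonal and reindexed matrices *)

Lemma det_castmx (R : comPzRingType) (p q : nat) (eq1 eq2 : p = q) (M : 'M[R]_p) :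
  \det (castmx (eq1, eq2) M) = \det M.
Proof. by subst q; rewrite castmx_id. Qed.

Lemma det_mx0 (R : comPzRingType) (n : nat) (M : 'M[R]_n) : n = 0%N -> \det M = 1.
Proof. by move=> n0; subst n; apply: det_mx00. Qed.

Lemma det_mxdiag (R : comPzRingType) (p : nat) (d : 'I_p -> nat)
    (D : forall i, 'M[R]_(d i)) :
  \det (\mxdiag_i D i) = \prod_i \det (D i).
Proof.
elim: p d D => [|p IHp] d D.
  by rewrite [RHS]big_ord0 det_mx0 ?big_ord0.
by rewrite mxdiag_recl det_castmx det_ublock big_ord_recl IHp.
Qed.

(** Rows and columns undergo the same permutation, so the two signs cancel. The sizes stay distinct
    because [n * r] and [\sum_(i < r) n] are equal only propositionally. *)
Lemma det_mxsub_bij (R : comPzRingType) (p q : nat) (g : 'I_p -> 'I_q)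
    (M : 'M[R]_q) :
  bijective g -> \det (mxsub g g M) = \det M.
Proof.
move=> g_bij; have eq_pq : p = q.
  by have := bij_eq_card g_bij; rewrite !card_ord.
subst q; pose s := perm (bij_inj g_bij).
have -> : mxsub g g M = row_perm s (col_perm s M).
  by apply/matrixP => i j; rewrite !mxE !permE.
rewrite row_permE col_permE !det_mulmx !det_perm odd_permV mulrCA -signr_addb.
by rewrite addbb mulr1.
Qed.

Lemma block_mx00 (R : Type) (r : nat) (a : 'M[R]_1) (b : 'rV[R]_r)
    (c : 'cV[R]_r) (D : 'M[R]_r) :
  (block_mx a b c D : 'M_(1 + r)) 0 0 = a 0 0.
Proof.
by rewrite -(block_mxEul a b c D); congr (block_mx _ _ _ _ _ _); apply: val_inj.
Qed.

(** * Coefficientwise extension of [L] to one-variable polynomials *)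

Section ExtPoly.

Variables (B C : comNzRingType) (n : nat) (L : {rmorphism B -> 'M[C]_n}).

Definition ext_poly (p : {poly B}) : 'M[{poly C}]_n :=
  \matrix_(i, j) map_poly (fun b => L b i j) p.

Lemma coef_ext_poly p i j k : (ext_poly p i j)`_k = L p`_k i j.
Proof. by rewrite mxE coef_map_id0 // raddf0 mxE. Qed.

Lemma ext_poly_is_zmod_morphism : zmod_morphism ext_poly.
Proof.
move=> p q; apply/matrixP => i j; apply/polyP => k.
by rewrite coef_ext_poly coefB raddfB !mxE coefB !coef_map_id0 // raddf0 mxE.
Qed.

Lemma ext_poly_is_monoid_morphism : monoid_morphism ext_poly.
Proof.
split=> [|p q]; apply/matrixP => i j; apply/polyP => k.
  rewrite coef_ext_poly coef1 mxE; case: k => [|k] /=.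
    by rewrite rmorph1 mxE; case: (i == j); rewrite ?coef1 ?coef0.
  by rewrite raddf0 mxE; case: (i == j); rewrite ?coef1 ?coef0.
rewrite coef_ext_poly coefM -mulmxE mxE rmorph_sum summxE coef_sum.
under eq_bigr => l _ do rewrite rmorphM -mulmxE mxE.
rewrite exchange_big; apply: eq_bigr => h _; rewrite coefM.
by apply: eq_bigr => l _; rewrite !coef_ext_poly.
Qed.

HB.instance Definition _ :=
  GRing.isZmodMorphism.Build {poly B} 'M[{poly C}]_n ext_poly
    ext_poly_is_zmod_morphism.
HB.instance Definition _ :=
  GRing.isMonoidMorphism.Build {poly B} 'M[{poly C}]_n ext_poly
    ext_poly_is_monoid_morphism.

(** The matrix is [X + L b], the characteristic matrix of [- L b]; its determinant is monic, hence
    regular. *)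
Lemma det_ext_polyXDC_lreg (b : B) : GRing.lreg (\det (ext_poly ('X + b%:P))).
Proof.
suff -> : ext_poly ('X + b%:P) = char_poly_mx (- L b).
  exact/monic_lreg/char_poly_monic.
apply/matrixP => i j; apply/polyP => k; rewrite coef_ext_poly !mxE.
rewrite coefD coefX coefC coefB coefMn coefX coefC.
rewrite raddfD !mxE.
case: k => [|[|k]] /=; rewrite ?rmorph1 ?raddf0 !mxE ?mul0rn ?coefN ?coefC /=;
  by rewrite ?mul0rn ?oppr0 ?opprK ?subr0 ?addr0 ?add0r.
Qed.

End ExtPoly.

(** * The determinant of a matrix with commuting blocks *)

Section BlockMap.

Variables (B C : comNzRingType) (n : nat) (L : {rmorphism B -> 'M[C]_n}).

Definition block_map (r : nat) (M : 'M[B]_r) : 'M[C]_(\sum_(i < r) n) :=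
  \mxblock_(i < r, j < r) L (M i j).

Lemma block_mapM (r : nat) (M N : 'M[B]_r) :
  block_map (M *m N) = block_map M *m block_map N.
Proof.
rewrite mul_mxblock; apply: eq_mxblock => i j.
by rewrite mxE rmorph_sum; apply: eq_bigr => k _; rewrite rmorphM.
Qed.

Lemma block_map_recl (r : nat) (M : 'M[B]_(1 + r)) :
  block_map M = castmx (mxsize_recl, mxsize_recl)
    (block_mx (L (M 0 0)) (\mxrow_j L (ursubmx M 0 j))
       (\mxcol_i L (dlsubmx M i 0)) (block_map (drsubmx M))).
Proof.
rewrite /block_map mxblock_recul; congr (castmx _ (block_mx _ _ _ _)).
- by apply: eq_mxrow => j; rewrite !mxE; congr (L (M _ _)); apply: val_inj.
- by apply: eq_mxcol => j; rewrite !mxE; congr (L (M _ _)); apply: val_inj.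
- by apply: eq_mxblock => i j; rewrite !mxE; congr (L (M _ _)); apply: val_inj.
Qed.

Lemma det_block_map_ublock (r : nat) (a : 'M[B]_1) (b : 'rV[B]_r) (D : 'M[B]_r) :
  \det (block_map (block_mx a b 0 D)) = \det (L (a 0 0)) * \det (block_map D).
Proof.
rewrite block_map_recl det_castmx block_mxKur block_mxKdl block_mxKdr.
under eq_mxcol do rewrite mxE raddf0.
by rewrite mxcol0 det_ublock block_mx00.
Qed.

Lemma det_block_map_lblock (r : nat) (a : 'M[B]_1) (c : 'cV[B]_r) (D : 'M[B]_r) :
  \det (block_map (block_mx a 0 c D)) = \det (L (a 0 0)) * \det (block_map D).
Proof.
rewrite block_map_recl det_castmx block_mxKur block_mxKdl block_mxKdr.
under eq_mxrow do rewrite mxE raddf0.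
by rewrite mxrow0 det_lblock block_mx00.
Qed.

Lemma det_block_map_scalar (r : nat) (a : B) :
  \det (block_map (a%:M : 'M_r)) = \det (L a) ^+ r.
Proof.
elim: r => [|r IHr].
  by rewrite expr0 det_mx0 ?big_ord0.
by rewrite (@scalar_mx_block _ 1 r) det_block_map_ublock IHr mxE exprS.
Qed.

End BlockMap.

Lemma det_block_map (r : nat) (B C : comNzRingType) (n : nat)
    (L : {rmorphism B -> 'M[C]_n}) (M : 'M[B]_r) :
  \det (block_map L M) = \det (L (\det M)).
Proof.
(* The rings are generalized because the induction hypothesis is applied over [{poly B}] and
   [{poly C}]. *)
elim: r B C n L M => [|r IHr] B C n L M.
  by rewrite det_mx00 rmorph1 det1 det_mx0 ?big_ord0.
have reg_case (B' C' : comNzRingType) (L' : {rmorphism B' -> 'M[C']_n})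
    (N : 'M[B']_(1 + r)) :
    GRing.lreg (\det (L' (N 0 0))) -> \det (block_map L' N) = \det (L' (\det N)).
  move=> reg_a; pose a := N 0 0; pose b := ursubmx N; pose c := dlsubmx N.
  (* To avoid division, [E] scales the lower rows by [a]; this costs a factor [a ^+ r] in the
     determinant, cancelled below. *)
  pose D := drsubmx N; pose E := block_mx 1%:M 0 (- c) a%:M : 'M_(1 + r).
  have N_ul : ulsubmx N = a%:M.
    by apply/matrixP => i j; rewrite !ord1 !mxE; congr (N _ _); apply: val_inj.
  have EN : E *m N = block_mx a%:M b 0 (a *: D - c *m b).
    rewrite -[N]submxK N_ul mulmx_block !mul1mx !mul0mx !addr0 mulNmx.
    by rewrite mul_mx_scalar mul_scalar_mx addNr mulNmx mul_scalar_mx addrC.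
  have detE : \det E = a ^+ r by rewrite det_lblock det1 mul1r det_scalar.
  have detLE : \det (block_map L' E) = \det (L' a) ^+ r.
    by rewrite det_block_map_lblock det_block_map_scalar mxE rmorph1 det1 mul1r.
  (* By regularity it suffices to compare after multiplication by [\det (L' a) ^+ r], which is both
     [\det (block_map L' E)] and [\det (L' (\det E))]. *)
  apply: (GRing.lregX (n := r) reg_a); rewrite -/a -{1}detLE -det_mulmx.
  rewrite -block_mapM EN det_block_map_ublock mxE IHr -det_mulmx mulmxE.
  rewrite -rmorphM.
  (* The factor [a *+ (0 == 0)] is the corner entry of [a%:M]. *)
  have -> : a *+ (0 == 0 :> 'I_1) * \det (a *: D - c *m b) = \det (E *m N).
    by rewrite EN det_ublock det_scalar1.
  rewrite det_mulmx detE rmorphM -mulmxE det_mulmx rmorphXn; congr (_ * _).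
  by elim: (r) => [|k IHk]; rewrite ?det1 // !exprS -mulmxE det_mulmx IHk.
pose Mx : 'M[{poly B}]_(1 + r) := 'X%:M + map_mx polyC M.
have Mx00 : Mx 0 0 = 'X + (M 0 0)%:P by rewrite !mxE.
have Mx_eval : map_mx (horner_eval 0) Mx = M.
  apply/matrixP => i j; rewrite !mxE /horner_eval hornerD hornerC hornerMn.
  by rewrite hornerX mul0rn add0r.
have L_eval (p : {poly B}) :
    map_mx (horner_eval 0) (ext_poly L p) = L (horner_eval 0 p).
  apply/matrixP => i j; rewrite !mxE /horner_eval !horner_coef0.
  by rewrite -coef_ext_poly mxE.
have reg_Mx : GRing.lreg (\det (ext_poly L (Mx 0 0))).
  by rewrite Mx00; apply: det_ext_polyXDC_lreg.
(* Evaluation at 0 commutes with determinants and turns [ext_poly L] back into [L], so the identity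
   for [Mx] specializes to [M]. *)
transitivity (horner_eval 0 (\det (block_map (ext_poly L) Mx))).
  rewrite -[RHS]det_map_mx; congr (\det _).
  by apply/matrixP => i j; rewrite !mxE -[in LHS]Mx_eval mxE -L_eval !mxE.
rewrite (reg_case _ _ _ _ reg_Mx) -[LHS]det_map_mx L_eval.
by rewrite -[horner_eval 0 _]det_map_mx Mx_eval.
Qed.

(** * Left regular representations as ring morphisms *)

Section LeftRegularMorphism.

Variables (A B : pzRingType) (iota : {rmorphism B -> A}).
Variables (m : nat) (e : 'I_m -> A) (he : right_basis iota e).

Lemma coordinatesB : {morph coordinates he : x y / x - y}.
Proof.
move=> x y; apply: coordinates_uniq.
rewrite {1}[x](coordinatesE he) {1}[y](coordinatesE he) -sumrB.
by apply: eq_bigr => i _; rewrite !ffunE rmorphB mulrBr.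
Qed.

Lemma coordinates_basis (j : 'I_m) :
  coordinates he (e j) = [ffun i => (i == j)%:R].
Proof.
apply: coordinates_uniq; rewrite (bigD1 j) //= ffunE eqxx rmorph1 mulr1.
by rewrite big1 ?addr0 // => i /negPf ij; rewrite ffunE ij rmorph0 mulr0.
Qed.

Lemma left_regular_is_zmod_morphism : zmod_morphism (left_regular he).
Proof.
by move=> x y; apply/matrixP => i j; rewrite !mxE mulrBl coordinatesB !ffunE.
Qed.

(** Left multiplication does not touch right coefficients: expanding [y * e j] and then each
    [x * e k] produces the entries of the matrix product, and coordinates are unique. *)
Lemma left_regular_is_monoid_morphism : monoid_morphism (left_regular he).
Proof.
split=> [|x y]; apply/matrixP => i j.
  by rewrite !mxE mul1r coordinates_basis ffunE.
rewrite mxE.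
suff /(coordinates_uniq he) -> : x * y * e j =
    \sum_i e i * iota ([ffun i => (left_regular he x *m left_regular he y) i j] i).
  by rewrite ffunE.
rewrite -mulrA (left_regularE he y) mulr_sumr.
under eq_bigr => k _ do rewrite mulrA (left_regularE he x) mulr_suml.
rewrite exchange_big; apply: eq_bigr => k _.
rewrite ffunE mxE rmorph_sum mulr_sumr.
by apply: eq_bigr => l _; rewrite rmorphM mulrA.
Qed.

HB.instance Definition _ :=
  GRing.isZmodMorphism.Build A 'M[B]_m (left_regular he)
    left_regular_is_zmod_morphism.
HB.instance Definition _ :=
  GRing.isMonoidMorphism.Build A 'M[B]_m (left_regular he)
    left_regular_is_monoid_morphism.

End LeftRegularMorphism.

(** As [B] is commutative, right multiplication by [(f j)%:M] scales each entry of [M] by [f j], so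
    coordinates are taken entrywise. *)
Lemma left_regular_scalar_mxE (B C : comPzRingType) (iota : {rmorphism C -> B})
    (n r : nat) (f : 'I_n -> B) (hf : right_basis iota f) (M : 'M[B]_r) i j u v :
  left_regular (right_basis_scalar_mx r hf) M i j u v
    = left_regular hf (M u v) i j.
Proof.
pose N : {ffun _ -> 'M[C]_r} :=
  [ffun i => \matrix_(u, v) left_regular hf (M u v) i j].
rewrite mxE (@coordinates_uniq _ _ _ _ _ _ _ N) ?ffunE ?mxE //.
have -> : M * (f j)%:M = f j *: M by apply: mul_mx_scalar.
apply/matrixP => k l; rewrite mxE mulrC.
rewrite (left_regularE hf) summxE; apply: eq_bigr => h _.
by rewrite -mulmxE mul_scalar_mx !mxE !ffunE !mxE.
Qed.

(** * Coefficientwise maps on multivariate polynomials *)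

Section MapMpoly.

Variables (R S : nzRingType) (N : nat).

Lemma map_mpoly_sum (f : R -> S) (p : {mpoly R[N]}) :
  map_mpoly f p = \sum_(mu <- msupp p) f p@_mu *: 'X_[mu].
Proof.
by rewrite /map_mpoly /mmap; apply: eq_bigr => mu _; rewrite mmap1_id mul_mpolyC.
Qed.

Lemma eq_map_mpoly (f g : R -> S) : f =1 g -> map_mpoly (n := N) f =1 map_mpoly g.
Proof.
by move=> fg p; rewrite !map_mpoly_sum; apply: eq_bigr => mu _; rewrite fg.
Qed.

Lemma map_mpoly0 (p : {mpoly R[N]}) : map_mpoly (fun=> 0 : S) p = 0.
Proof. by rewrite map_mpoly_sum big1 // => mu _; rewrite scale0r. Qed.

(** Monomials outside the support contribute [f 0 = 0]. One list of monomials can thus serve all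
    entries of a matrix, as in [mx_msupp]. *)
Lemma map_mpoly_sum_sub (f : R -> S) (p : {mpoly R[N]}) (s : seq 'X_{1..N}) :
  f 0 = 0 -> uniq s -> {subset msupp p <= s} ->
  map_mpoly f p = \sum_(mu <- s) f p@_mu *: 'X_[mu].
Proof.
move=> f0 s_uniq ps; rewrite map_mpoly_sum.
rewrite [RHS](bigID (mem (msupp p))) /= [X in _ + X]big1 ?addr0.
  rewrite -[RHS]big_filter; apply/perm_big/uniq_perm; rewrite ?filter_uniq //.
  by move=> mu; rewrite mem_filter; case: (boolP (mu \in msupp p)) => //= /ps.
by move=> mu /memN_msupp_eq0 ->; rewrite f0 scale0r.
Qed.

Lemma mcoeff_map_mpoly0 (f : R -> S) (p : {mpoly R[N]}) mu :
  f 0 = 0 -> (map_mpoly f p)@_mu = f p@_mu.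
Proof.
move=> f0; pose s := undup (mu :: msupp p).
rewrite (@map_mpoly_sum_sub f p s) ?undup_uniq //; last first.
  by move=> nu nu_p; rewrite mem_undup inE nu_p orbT.
rewrite raddf_sum (bigD1_seq mu) ?undup_uniq ?mem_undup ?mem_head //=.
rewrite mcoeffZ mcoeffX eqxx mulr1 big1 ?addr0 // => nu /negPf nu_mu.
by rewrite mcoeffZ mcoeffX nu_mu mulr0.
Qed.

End MapMpoly.

(** In this form, monomials times constant matrices, conjugation by a constant matrix acts
    termwise. *)
Lemma ext_mpoly_sum (S : nzRingType) (R : comNzRingType) (N k : nat)
    (f : S -> 'M[R]_k) (p : {mpoly S[N]}) :
  ext_mpoly f p
    = \sum_(mu <- msupp p) 'X_[mu] *: map_mx (@mpolyC N R) (f p@_mu).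
Proof.
apply/matrixP => i j; rewrite mxE map_mpoly_sum summxE.
by apply: eq_bigr => mu _; rewrite !mxE mulrC mul_mpolyC.
Qed.

Section ExtMpoly.

Variables (S R : nzRingType) (N k : nat) (f : {rmorphism S -> 'M[R]_k}).

Lemma mcoeff_ext_mpoly (p : {mpoly S[N]}) i j mu :
  (ext_mpoly f p i j)@_mu = f p@_mu i j.
Proof. by rewrite mxE mcoeff_map_mpoly0 // raddf0 mxE. Qed.

Lemma ext_mpoly_is_zmod_morphism : zmod_morphism (ext_mpoly (N := N) f).
Proof.
move=> p q; apply/matrixP => i j; apply/mpolyP => mu.
rewrite mcoeff_ext_mpoly mcoeffB raddfB !mxE mcoeffB.
by rewrite !mcoeff_map_mpoly0 // raddf0 mxE.
Qed.

Lemma ext_mpoly_is_monoid_morphism : monoid_morphism (ext_mpoly (N := N) f).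
Proof.
split=> [|p q]; apply/matrixP => i j; apply/mpolyP => mu.
  rewrite mcoeff_ext_mpoly mcoeff1 [X in _ = X@__]mxE mcoeffMn mcoeff1.
  by case: (mu == 0%MM); rewrite ?rmorph1 ?raddf0 mxE ?mul0rn.
rewrite mcoeff_ext_mpoly mcoeffM -mulmxE mxE rmorph_sum summxE raddf_sum.
under eq_bigr => l _ do rewrite rmorphM -mulmxE mxE.
rewrite exchange_big; apply: eq_bigr => h _; rewrite /= mcoeffM.
by apply: eq_bigr => l _; rewrite !mcoeff_ext_mpoly.
Qed.

HB.instance Definition _ :=
  GRing.isZmodMorphism.Build {mpoly S[N]} 'M[{mpoly R[N]}]_k (ext_mpoly f)
    ext_mpoly_is_zmod_morphism.
HB.instance Definition _ :=
  GRing.isMonoidMorphism.Build {mpoly S[N]} 'M[{mpoly R[N]}]_k (ext_mpoly f)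
    ext_mpoly_is_monoid_morphism.

End ExtMpoly.

(** * Determinants under direct sums and equivalence *)

Lemma ext_mpoly_mxdiag (S R : nzRingType) (N t : nat) (d : 'I_t -> nat)
    (psi : forall j, S -> 'M[R]_(d j)) (p : {mpoly S[N]}) :
  ext_mpoly (fun a => \mxdiag_j psi j a) p = \mxdiag_j ext_mpoly (psi j) p.
Proof.
apply/matrixP => u v; rewrite mxE [RHS]mxE.
pose D a : 'M_(d (tagnat.sig1 u), d (tagnat.sig1 v)) :=
  if tagnat.sig1 u == tagnat.sig1 v then conform_mx 0 (psi (tagnat.sig1 u) a)
  else 0.
transitivity (map_mpoly (fun a => D a (tagnat.sig2 u) (tagnat.sig2 v)) p).
  by apply: eq_map_mpoly => a; rewrite mxE.
(* Generalizing the block indices allows equal ones to be identified, after which [conform_mx] is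
   the identity. *)
rewrite {}/D; move: (tagnat.sig1 u) (tagnat.sig2 u) (tagnat.sig1 v) (tagnat.sig2 v).
move=> i x j y; case: eqVneq => [eij|_].
  subst j; rewrite conform_mx_id mxE; apply: eq_map_mpoly => a.
  by rewrite conform_mx_id.
rewrite [RHS]mxE -[RHS](map_mpoly0 R p).
by apply: eq_map_mpoly => a; rewrite mxE.
Qed.

Lemma det_ext_mpoly_equiv (S : nzRingType) (K : comNzRingType) (N k l : nat)
    (R1 : S -> 'M[K]_k) (R2 : S -> 'M[K]_l) (p : {mpoly S[N]}) :
  rep_equiv R1 R2 -> \det (ext_mpoly R1 p) = \det (ext_mpoly R2 p).
Proof.
case=> eqp [P [Q [PQ _ R1E]]]; subst k.
pose up := map_mx (@mpolyC N K) : 'M_l -> 'M_l.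
have -> : ext_mpoly R1 p = up P *m ext_mpoly R2 p *m up Q.
  rewrite !ext_mpoly_sum mulmx_sumr mulmx_suml; apply: eq_bigr => mu _.
  by rewrite R1E castmx_id -scalemxAr -scalemxAl !map_mxM.
by rewrite !det_mulmx mulrAC -det_mulmx -map_mxM PQ map_mx1 det1 mul1r.
Qed.

Lemma map_ext_mpoly (S : nzRingType) (R K : comNzRingType) (N k : nat)
    (g : {rmorphism R -> K}) (f : S -> 'M[R]_k) (p : {mpoly S[N]}) :
  map_mx (map_mpoly g) (ext_mpoly f p) = ext_mpoly (fun a => map_mx g (f a)) p.
Proof.
apply/matrixP => i j; rewrite !mxE.
rewrite [map_mpoly _ p]map_mpoly_sum [RHS]map_mpoly_sum rmorph_sum.
by apply: eq_bigr => mu _; rewrite /= map_mpolyZ map_mpolyX mxE.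
Qed.

(** Both outer equalities are instances: [f] is the composite of [L3] and [rho], or [L2]. *)
Lemma det_ext_mpoly_decomp (S : nzRingType) (R K : comNzRingType) (N k t : nat)
    (g : {rmorphism R -> K}) (f : S -> 'M[R]_k) (d : 'I_t -> nat)
    (psi : forall j, S -> 'M[K]_(d j)) (p : {mpoly S[N]}) :
  rep_equiv (fun a => map_mx g (f a)) (fun a => \mxdiag_j psi j a) ->
  map_mpoly g (\det (ext_mpoly f p)) = \prod_j \det (ext_mpoly (psi j) p).
Proof.
move=> equiv; rewrite -det_map_mx map_ext_mpoly (det_ext_mpoly_equiv _ equiv).
by rewrite ext_mpoly_mxdiag det_mxdiag.
Qed.

Lemma mem_mx_msupp (S : nzRingType) (N k : nat) (M : 'M[{mpoly S[N]}]_k) i j :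
  {subset msupp (M i j) <= mx_msupp M}.
Proof.
move=> mu mu_M; rewrite mem_undup; apply/flattenP.
by exists (msupp (M i j)) => //; apply/imageP; exists (i, j).
Qed.

(** Serves for [L3], each entry of which depends on a single entry of its argument. *)
Lemma ext_mx_mpolyE (S R : nzRingType) (N k l : nat) (F : 'M[S]_k -> 'M[R]_l)
    (q : 'I_l -> 'I_k) (g : 'I_l -> 'I_l -> S -> R) (M : 'M[{mpoly S[N]}]_k) :
  (forall u v, g u v 0 = 0) ->
  (forall M' u v, F M' u v = g u v (M' (q u) (q v))) ->
  ext_mx_mpoly F M = \matrix_(u, v) map_mpoly (g u v) (M (q u) (q v)).
Proof.
move=> g0 FE; apply/matrixP => u v; rewrite !mxE.
rewrite (@map_mpoly_sum_sub _ _ _ _ _ (mx_msupp M)) ?undup_uniq //.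
  by apply: eq_bigr => mu _; rewrite FE mxE.
exact: mem_mx_msupp.
Qed.

(** * Flattened indices and the comparison of [L3] with blocks of [L2] *)

Definition flatten_block n r (u : 'I_(n * r)) : 'I_n :=
  tagnat.sig1 (cast_ord (esym (flatten_mx_size n r)) u).

Definition flatten_offset n r (u : 'I_(n * r)) : 'I_r :=
  tagnat.sig2 (cast_ord (esym (flatten_mx_size n r)) u).

Lemma flatten_mxE (R : Type) (n r : nat) (M : 'M['M[R]_r]_n) u v :
  flatten_mx M u v
    = M (flatten_block u) (flatten_block v) (flatten_offset u) (flatten_offset v).
Proof. by rewrite castmxE mxE. Qed.

(* L3 indexes M(nr, C) by (block, offset) with the coordinate along f first;
   swapping the two turns it into the matrix with blocks L2 (M i j). *)
Definition flatten_swap n r (u : 'I_(n * r)) : 'I_(\sum_(i < r) n) :=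
  tagnat.Rank (flatten_offset u) (flatten_block u).

Lemma flatten_swap_bij n r : bijective (@flatten_swap n r).
Proof.
apply: inj_card_bij => [u v uv|]; last by rewrite !card_ord flatten_mx_size mulnC.
have eq_off : flatten_offset u = flatten_offset v.
  by have := congr1 (@tagnat.sig1 _ _) uv; rewrite !tagnat.Rank1K.
have eq_blk : flatten_block u = flatten_block v.
  (* In [nat] the cast introduced by [tagnat.Rank2K] disappears. *)
  have := congr1 (fun x => tagnat.sig2 x : nat) uv.
  by rewrite !tagnat.Rank2K /= => /val_inj.
apply: (@cast_ord_inj _ _ (esym (flatten_mx_size n r))).
rewrite -[LHS]tagnat.sig2K -[RHS]tagnat.sig2K.
by move: eq_off eq_blk; rewrite /flatten_offset /flatten_block => -> ->.
Qed.

Section FlatRegular.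

Variables (B C : comNzRingType) (iota : {rmorphism C -> B}) (n r N : nat).
Variables (f : 'I_n -> B) (hf : right_basis iota f).

Let L2 : {rmorphism B -> 'M[C]_n} := left_regular hf.
Let L3 (M : 'M[B]_r) : 'M[C]_(n * r) :=
  flatten_mx (left_regular (right_basis_scalar_mx r hf) M).

Lemma flat_regularE (M : 'M[B]_r) u v :
  L3 M u v = L2 (M (flatten_offset u) (flatten_offset v))
               (flatten_block u) (flatten_block v).
Proof. by rewrite flatten_mxE left_regular_scalar_mxE. Qed.

Let L2_entry (u v : 'I_(n * r)) (b : B) : C :=
  L2 b (flatten_block u) (flatten_block v).

Let L2_entry0 u v : L2_entry u v 0 = 0.
Proof. by rewrite /L2_entry raddf0 mxE. Qed.

Let ext_mx_L3E (M : 'M[{mpoly B[N]}]_r) :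
  ext_mx_mpoly L3 M
    = \matrix_(u, v)
        map_mpoly (L2_entry u v) (M (flatten_offset u) (flatten_offset v)).
Proof. exact: ext_mx_mpolyE L2_entry0 flat_regularE. Qed.

(** Up to a simultaneous reindexing of rows and columns, this reduces [L3] to the commuting-block
    theorem for [ext_mpoly L2]. *)
Lemma ext_flat_regularE (M : 'M[{mpoly B[N]}]_r) :
  ext_mx_mpoly L3 M
    = mxsub (@flatten_swap n r) (@flatten_swap n r) (block_map (ext_mpoly L2) M).
Proof.
rewrite ext_mx_L3E; apply/matrixP => u v.
rewrite !mxE !tagnat.Rank1K !tagnat.Rank2K.
by apply: eq_map_mpoly => b; congr (L2 b _ _); apply: val_inj.
Qed.

Lemma det_ext_flat_regular (M : 'M[{mpoly B[N]}]_r) :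
  \det (ext_mx_mpoly L3 M) = \det (ext_mpoly L2 (\det M)).
Proof.
rewrite ext_flat_regularE det_mxsub_bij ?det_block_map //.
exact: flatten_swap_bij.
Qed.

(** Links the decomposition, which concerns the composite of [L3] and [rho], with the determinant of
    [L3] applied to [rhoX]. *)
Lemma ext_flat_regular_comp (S : nzRingType) (h : S -> 'M[B]_r)
    (p : {mpoly S[N]}) :
  h 0 = 0 -> ext_mx_mpoly L3 (ext_mpoly h p) = ext_mpoly (L3 \o h) p.
Proof.
move=> h0; rewrite ext_mx_L3E; apply/matrixP => u v; rewrite !mxE.
apply/mpolyP => mu; rewrite !mcoeff_map_mpoly0 /= ?flat_regularE ?h0 //.
- by rewrite [X in L2 X]mxE; apply: L2_entry0.
- by rewrite mxE.
Qed.

End FlatRegular.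

Theorem corollary1p2 (A : nzRingType) (B C Cbar : comNzRingType)
    (iBA : {rmorphism B -> A}) (iCB : {rmorphism C -> B})
    (iC : {rmorphism C -> Cbar}) (iC_inj : injective iC)
    (m n r : nat) (e : 'I_m -> A) (f : 'I_n -> B)
    (he : right_basis iBA e) (hf : right_basis iCB f)
    (rho : {rmorphism A -> 'M[B]_r})
    (s : nat) (d : 'I_s -> nat)
    (phi : forall i : 'I_s, {rmorphism A -> 'M[Cbar]_(d i)})
    (t : nat) (d' : 'I_t -> nat)
    (psi : forall j : 'I_t, {rmorphism B -> 'M[Cbar]_(d' j)}) :
  let L2 : B -> 'M[C]_n := left_regular hf in
  let L3 : 'M[B]_r -> 'M[C]_(n * r) :=
    fun M => flatten_mx (left_regular (right_basis_scalar_mx r hf) M) in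
  let X : {mpoly A[m * n]} := general_element iBA e f in
  let rhoX : 'M[{mpoly B[m * n]}]_r := ext_mpoly rho X in
  rep_equiv (fun a : A => map_mx iC (L3 (rho a)))
            (fun a : A => \mxdiag_(i < s) phi i a) ->
  rep_equiv (fun b : B => map_mx iC (L2 b))
            (fun b : B => \mxdiag_(j < t) psi j b) ->
  [/\ \prod_(i < s) \det (ext_mpoly (phi i) X)
        = map_mpoly iC (\det (ext_mx_mpoly L3 rhoX)),
      \det (ext_mx_mpoly L3 rhoX) = \det (ext_mpoly L2 (\det rhoX))
    & map_mpoly iC (\det (ext_mpoly L2 (\det rhoX)))
        = \prod_(j < t) \det (ext_mpoly (psi j) (\det rhoX))].
Proof.
move=> L2 L3 X rhoX phi_equiv psi_equiv; split.
- rewrite ext_flat_regular_comp ?raddf0 //.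
  by apply/esym/det_ext_mpoly_decomp.
- exact: det_ext_flat_regular.
- exact: det_ext_mpoly_decomp.
Qed.
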